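(* Let the problem (P) be Fréchet differentiable. Then every second-order Kuhn-Tucker stationary point of (P) is a weak global Pareto minimizer of (P) if and only if (P) is second-order KT-pseudoinvex-I.
   Context: All vector inequalities are componentwise. Problem (P): minimize $f(x)$ subject to $x\in X$, $g(x)\le 0$, where $X\subset\mathbb{R}^s$ is open, $f=(f_1,\dots,f_n):X\to\mathbb{R}^n$, $g=(g_1,\dots,g_m):X\to\mathbb{R}^m$. $S=\{x\in X: g(x)\le 0\}$; for $x\in S$, $A(x)=\{j: g_j(x)=0\}$. (P) is Fréchet differentiable if $f$ and $g$ are Fréchet differentiable on $X$. A direction $d\in\mathbb{R}^s$ is critical at $x\in S$ if $\nabla f_i(x)d\le 0$ for all $i$ and $\nabla g_j(x)d\le 0$ for all $j\in A(x)$; $D(x)$ denotes the set of critical directions at $x$. For $h:X\to\mathbb{R}$ differentiable at $x$, the second-order directional derivative in direction $d\in\mathbb{R}^s$ is $h''(x,d)=\lim_{t\to+0}2t^{-2}[h(x+td)-h(x)-t\nabla h(x)d]$. A point $x\in S$ is a weak global Pareto minimizer if there is no $y\in S$ with $f_i(y)<f_i(x)$ for all $i=1,\dots,n$. A point $x\in S$ is a second-order Kuhn-Tucker stationary point if for every critical direction $d\in\mathbb{R}^s$ at $x$ such that the derivatives $f_i''(x,d)$ ($i=1,\dots,n$) and $g_j''(x,d)$ ($j\in A(x)$) exist with finite values, there are $\lambda\in\mathbb{R}^n$, $\lambda\ge0$, $\lambda\ne0$, and $\mu\in\mathbb{R}^m$, $\mu\ge0$ (possibly depending on $d$), with $\mu_jg_j(x)=0$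 for all $j$, $\sum_{i=1}^n\lambda_i\nabla f_i(x)+\sum_{j\in A(x)}\mu_j\nabla g_j(x)=0$, and $\sum_{i=1}^n\lambda_if_i''(x,d)+\sum_{j\in A(x)}\mu_jg_j''(x,d)\ge0$. A Fréchet differentiable problem (P) is second-order KT-pseudoinvex-I if there exist maps $d:X\times X\to\mathbb{R}^s$, $\eta:X\times X\to\mathbb{R}^s$ and a function $\omega:X\times X\to[0,+\infty)$ such that for all $x,y\in X$ with $g(x)\le0$, $g(y)\le0$ and $f_i(y)<f_i(x)$ for all $i=1,\dots,n$: $d(x,y)\in D(x)$; the derivatives $f_i''(x,d(x,y))$ ($i=1,\dots,n$) and $g_j''(x,d(x,y))$ ($j\in A(x)$) exist with finite values; $\nabla f_i(x)\eta(x,y)+\omega(x,y)f_i''(x,d(x,y))<0$ for all $i=1,\dots,n$; and $\nabla g_j(x)\eta(x,y)+\omega(x,y)g_j''(x,d(x,y))\le0$ for all $j\in A(x)$. *)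

(* Defs.v *)
From HB Require Import structures.
From mathcomp Require Import all_boot all_order all_algebra.
From mathcomp Require Import all_classical all_reals all_analysis.

Set Implicit Arguments.
Unset Strict Implicit.
Unset Printing Implicit Defensive.

Import Order.TTheory GRing.Theory Num.Theory.
Import numFieldNormedType.Exports.

Local Open Scope classical_set_scope.
Local Open Scope ring_scope.

(* A map X -> R^p on an open X is represented by a total map on the whole
   space. Its values outside X are irrelevant: below it is evaluated, and its
   derivatives are taken, only at points of X, and these derivatives depend
   only on the values near the point. *)

Definition comp_fun (R : realType) (s p : nat) (f : 'rV[R]_s -> 'rV[R]_p)
    (i : 'I_p) : 'rV[R]_s -> R :=
  fun x => f x 0 i.

Definition gradient (R : realType) (s : nat) (h : 'rV[R]_s -> R)
    (x : 'rV[R]_s) : 'rV[R]_s :=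
  \row_k 'd h x (delta_mx 0 k).

(* The product of the gradient of h at x with d. *)
Definition grad_dot (R : realType) (s : nat) (h : 'rV[R]_s -> R)
    (x d : 'rV[R]_s) : R :=
  (gradient h x *m d^T) 0 0.

Definition snd_quotient (R : realType) (s : nat) (h : 'rV[R]_s -> R)
    (x d : 'rV[R]_s) (t : R) : R :=
  2 * t ^- 2 * (h (x + t *: d) - h x - t * grad_dot h x d).

(* Convergence is in R, so the limit is finite. *)
Definition snd_derivable (R : realType) (s : nat) (h : 'rV[R]_s -> R)
    (x d : 'rV[R]_s) : Prop :=
  cvg (snd_quotient h x d t @[t --> 0^'+]).

(* Meaningful only under [snd_derivable h x d]. *)
Definition snd_derive (R : realType) (s : nat) (h : 'rV[R]_s -> R)
    (x d : 'rV[R]_s) : R :=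
  lim (snd_quotient h x d t @[t --> 0^'+]).

Definition frechet_differentiable (R : realType) (s n m : nat)
    (X : set 'rV[R]_s) (f : 'rV[R]_s -> 'rV[R]_n) (g : 'rV[R]_s -> 'rV[R]_m)
    : Prop :=
  forall x, X x -> differentiable f x /\ differentiable g x.

Definition feasible (R : realType) (s m : nat) (X : set 'rV[R]_s)
    (g : 'rV[R]_s -> 'rV[R]_m) : set 'rV[R]_s :=
  [set x | X x /\ forall j, g x 0 j <= 0].

Definition active (R : realType) (s m : nat) (g : 'rV[R]_s -> 'rV[R]_m)
    (x : 'rV[R]_s) : {set 'I_m} :=
  [set j | g x 0 j == 0]%SET.

Definition critical (R : realType) (s n m : nat) (f : 'rV[R]_s -> 'rV[R]_n)
    (g : 'rV[R]_s -> 'rV[R]_m) (x : 'rV[R]_s) : set 'rV[R]_s :=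
  [set d | (forall i, grad_dot (comp_fun f i) x d <= 0) /\
           (forall j, j \in active g x -> grad_dot (comp_fun g j) x d <= 0)].

Definition problem_snd_derivable (R : realType) (s n m : nat)
    (f : 'rV[R]_s -> 'rV[R]_n) (g : 'rV[R]_s -> 'rV[R]_m)
    (x d : 'rV[R]_s) : Prop :=
  (forall i, snd_derivable (comp_fun f i) x d) /\
  (forall j, j \in active g x -> snd_derivable (comp_fun g j) x d).

Definition weak_global_pareto_minimizer (R : realType) (s n m : nat)
    (X : set 'rV[R]_s) (f : 'rV[R]_s -> 'rV[R]_n) (g : 'rV[R]_s -> 'rV[R]_m)
    (x : 'rV[R]_s) : Prop :=
  feasible X g x /\
  ~ exists2 y, feasible X g y & forall i, f y 0 i < f x 0 i.

Definition snd_KT_stationary (R : realType) (s n m : nat)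
    (X : set 'rV[R]_s) (f : 'rV[R]_s -> 'rV[R]_n) (g : 'rV[R]_s -> 'rV[R]_m)
    (x : 'rV[R]_s) : Prop :=
  feasible X g x /\
  forall d, critical f g x d -> problem_snd_derivable f g x d ->
  exists (lambda : 'rV[R]_n) (mu : 'rV[R]_m),
    [/\ (forall i, 0 <= lambda 0 i) /\ lambda != 0,
        forall j, 0 <= mu 0 j,
        forall j, mu 0 j * g x 0 j = 0,
        \sum_i lambda 0 i *: gradient (comp_fun f i) x +
          \sum_(j in active g x) mu 0 j *: gradient (comp_fun g j) x = 0 &
        0 <= \sum_i lambda 0 i * snd_derive (comp_fun f i) x d +
          \sum_(j in active g x) mu 0 j * snd_derive (comp_fun g j) x d].

Definition snd_KT_pseudoinvex_I (R : realType) (s n m : nat)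
    (X : set 'rV[R]_s) (f : 'rV[R]_s -> 'rV[R]_n) (g : 'rV[R]_s -> 'rV[R]_m)
    : Prop :=
  exists (d eta : 'rV[R]_s -> 'rV[R]_s -> 'rV[R]_s)
         (omega : 'rV[R]_s -> 'rV[R]_s -> R),
    (forall x y, X x -> X y -> 0 <= omega x y) /\
    forall x y, feasible X g x -> feasible X g y ->
      (forall i, f y 0 i < f x 0 i) ->
      [/\ critical f g x (d x y),
          problem_snd_derivable f g x (d x y),
          forall i, grad_dot (comp_fun f i) x (eta x y) +
            omega x y * snd_derive (comp_fun f i) x (d x y) < 0 &
          forall j, j \in active g x ->
            grad_dot (comp_fun g j) x (eta x y) +
            omega x y * snd_derive (comp_fun g j) x (d x y) <= 0].

(* Main.v *)
Require Import Defs.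
From mathcomp Require Import all_boot all_order all_algebra.
From mathcomp Require Import all_classical all_reals all_analysis.
Import numFieldNormedType.Exports.
Local Open Scope classical_set_scope.
Local Open Scope ring_scope.

Set Implicit Arguments.
Unset Strict Implicit.
Unset Printing Implicit Defensive.

Import Order.TTheory GRing.Theory Num.Theory.

(** At a fixed point x and a fixed critical direction d, both sides speak about
    the same finite data: the gradients and the second-order derivatives of the
    objectives and of the active constraints. Regard (eta, omega), with
    omega >= 0, as one unknown vector. The inequalities required by
    pseudoinvexity form a homogeneous linear system in it, strict for the
    objectives and weak for the active constraints, and the Kuhn-Tucker
    multipliers (lambda, mu) are exactly the certificates that this system has
    no solution. The nonnegative multiplier of the constraint - omega <= 0 is
    the slack that turns an equation in the last coordinate into the
    second-order inequality 0 <= sum lambda_i f_i'' + sum mu_j g_j''.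

    So the theorem is Motzkin's transposition theorem ([motzkin]), applied for
    each x and d in the form [direction_or_multipliers], together with its
    elementary half [direction_multipliers_absurd]. If the problem is
    pseudoinvex, a stationary x that is dominated by some y would have
    multipliers for the direction d(x, y), although (eta, omega)(x, y) solves
    the system. Conversely, when stationary points are minimizers, a dominated
    feasible x is not stationary, hence some critical direction at x admits no
    multipliers, and the transposition theorem produces eta and omega for that
    direction; the maps are assembled by choice.

    [motzkin] follows from the Farkas lemma by homogenization, and [farkas] is
    proved by induction on the number of inequalities, which uses only ordered
    field arithmetic and no separation or compactness argument. *)

(** * Theorems of the alternative *)

(** The induction removes the first inequality a x <= 0. If the remaining ones
    leave a point y with b y > 0, either y satisfies a y <= 0 too, or it can be
    scaled to a y = 1. In the second case the projection x |-> x - (a x) y onto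
    the kernel of a transforms the remaining inequalities, and the induction
    hypothesis applies to the transformed system. *)
Lemma farkas (R : realFieldType) (m p : nat) (A : 'M[R]_(m, p)) (b : 'rV[R]_p) :
  (exists2 x : 'cV[R]_p, forall i, (A *m x) i 0 <= 0 & 0 < (b *m x) 0 0) \/
  (exists2 l : 'rV[R]_m, forall i, 0 <= l 0 i & l *m A = b).
Proof.
elim: m A b => [|m IHm] A b.
  have [b0|b0] := eqVneq b 0.
    by right; exists 0 => [[]//|]; rewrite mul0mx b0.
  left; exists b^T => [[]//|].
  have sqE : (b *m b^T) 0 0 = \sum_k b 0 k ^+ 2.
    by rewrite mxE; apply: eq_bigr => k _; rewrite mxE expr2.
  rewrite sqE lt_def sumr_ge0 => [|k _]; last exact: sqr_ge0.
  rewrite andbT psumr_eq0 => [|k _]; last exact: sqr_ge0.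
  apply: contraNN b0 => /allP b0; apply/eqP/rowP => k; rewrite mxE.
  by apply/eqP; rewrite -sqrf_eq0; apply: b0; rewrite mem_index_enum.
rewrite -[m.+1]/(1 + m)%N in A *.
rewrite -[A]vsubmxK; move: (usubmx A) (dsubmx A) => a B {A}.
have [[x Bx bx]|[l l0 lB]] := IHm B b; last first.
  right; exists (row_mx 0 l) => [i|]; last by rewrite mul_row_col mul0mx add0r.
  by rewrite mxE; case: splitP => j _; rewrite ?mxE.
have [ax|ax] := leP ((a *m x) 0 0) 0.
  left; exists x => // i; rewrite mul_col_mx mxE.
  by case: splitP => j _ //; rewrite ord1.
set y := ((a *m x) 0 0)^-1 *: x.
have ay : a *m y = 1%:M.
  by rewrite -scalemxAr [a *m x]mx11_scalar scale_scalar_mx mxE mulVf // gt_eqF.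
have By i : (B *m y) i 0 <= 0.
  by rewrite -scalemxAr mxE mulr_ge0_le0 // invr_ge0 ltW.
have by0 : 0 <= (b *m y) 0 0.
  by rewrite -scalemxAr mxE mulr_ge0 ?invr_ge0 ?ltW.
have [[z Bz bz]|[l l0 lB]] :=
    IHm (B - B *m y *m a) (b - b *m y *m a).
  (* w is the projection of z onto the kernel of a, along y. *)
  pose w := z - y *m (a *m z).
  have projE k (C : 'M[R]_(k, p)) : C *m w = (C - C *m y *m a) *m z.
    by rewrite mulmxBr mulmxBl !mulmxA.
  have aw : a *m w = 0 by rewrite projE ay mul1mx subrr mul0mx.
  left; exists w; last by rewrite projE.
  move=> i; rewrite mul_col_mx mxE.
  by case: splitP => j _; [rewrite aw mxE | rewrite projE].
right; exists (row_mx (b *m y - l *m (B *m y)) l); last first.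
  move: lB; rewrite mul_row_col mulmxBl mulmxBr !mulmxA => /eqP.
  rewrite subr_eq => /eqP lB; rewrite [X in _ + X]lB.
  by rewrite addrACA addNr addr0 addrC subrK.
move=> i; rewrite mxE; case: splitP => j _ //.
rewrite ord1 mxE [X in _ + X]mxE subr_ge0 (le_trans _ by0) // mxE.
by apply: sumr_le0 => k _; rewrite mulr_ge0_le0.
Qed.

(** Homogenization: F z < 0 is solvable exactly when F z + e <= 0 is for some
    e > 0. The extra unknown e makes the Farkas multipliers of F sum to 1,
    hence nonzero. *)
Lemma motzkin (R : realFieldType) (n m p : nat)
    (F : 'M[R]_(n, p)) (G : 'M[R]_(m, p)) :
  (exists2 z : 'cV[R]_p,
     forall i, (F *m z) i 0 < 0 & forall j, (G *m z) j 0 <= 0) \/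
  (exists (l : 'rV[R]_n) (u : 'rV[R]_m),
     [/\ forall i, 0 <= l 0 i, l != 0, forall j, 0 <= u 0 j &
         l *m F + u *m G = 0]).
Proof.
have [[z Az bz]|[l l0 lA]] :=
    farkas (col_mx (row_mx F (const_mx 1)) (row_mx G 0))
           (row_mx 0 1%:M : 'rV[R]_(p + 1)).
  move: bz Az; rewrite -[z]vsubmxK mul_row_col mul0mx add0r mul1mx.
  move: (usubmx z) (dsubmx z) => {}z e e0.
  rewrite mul_col_mx !mul_row_col mul0mx addr0 => Az.
  left; exists z => k; last by have := Az (rshift n k); rewrite col_mxEd.
  have := Az (lshift m k); rewrite col_mxEu [X in X <= _]mxE [(const_mx 1 *m e) _ _]mxE.
  rewrite big_ord1 [const_mx 1 _ _]mxE mul1r => Fe.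
  by rewrite -(ltrD2r (e 0 0)) add0r (le_lt_trans Fe).
right; exists (lsubmx l), (rsubmx l); move: lA.
rewrite -[l in l *m _]hsubmxK mul_row_col !mul_mx_row add_row_mx mulmx0 addr0.
move=> /eq_row_mx[lFG l1]; split=> // [i||j]; rewrite ?mxE //.
apply/eqP => l00; move: l1; rewrite l00 mul0mx => /matrixP/(_ 0 0).
by rewrite !mxE => /eqP; rewrite eq_sym oner_eq0.
Qed.

(** * Second-order directions and multipliers *)

(** The unknown is the column (eta, omega), and - omega <= 0 is added as one
    more weak inequality. Inequalities outside J are replaced by 0 <= 0. *)
Lemma direction_or_multipliers (R : realFieldType) (s n m : nat)
    (u : 'I_n -> 'rV[R]_s) (a : 'I_n -> R)
    (v : 'I_m -> 'rV[R]_s) (c : 'I_m -> R) (J : {set 'I_m}) :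
  (exists (eta : 'rV[R]_s) (omega : R),
     [/\ 0 <= omega,
         forall i, (u i *m eta^T) 0 0 + omega * a i < 0 &
         forall j, j \in J -> (v j *m eta^T) 0 0 + omega * c j <= 0]) \/
  (exists (lambda : 'rV[R]_n) (mu : 'rV[R]_m),
     [/\ (forall i, 0 <= lambda 0 i) /\ lambda != 0,
         forall j, 0 <= mu 0 j,
         forall j, j \notin J -> mu 0 j = 0,
         \sum_i lambda 0 i *: u i + \sum_(j in J) mu 0 j *: v j = 0 &
         0 <= \sum_i lambda 0 i * a i + \sum_(j in J) mu 0 j * c j]).
Proof.
pose U : 'M[R]_(n, s) := \matrix_(i, k) u i 0 k.
pose V : 'M[R]_(m, s) := \matrix_(j, k) (if j \in J then v j 0 k else 0).
pose ca : 'cV[R]_n := \col_i a i.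
pose cc : 'cV[R]_m := \col_j (if j \in J then c j else 0).
have [[z Fz Gz]|[l [w [l0 lN0 w0]]]] :=
    motzkin (row_mx U ca) (col_mx (row_mx V cc) (row_mx 0 (- 1%:M : 'M[R]_1))).
  move: Fz Gz; rewrite -[z]vsubmxK mul_col_mx !mul_row_col.
  move: (usubmx z) (dsubmx z) => eta omega Fz Gz.
  left; exists eta^T, (omega 0 0); rewrite trmxK; split=> [|i|j jJ].
  - have := Gz (rshift m 0).
    by rewrite col_mxEd mul0mx add0r mulNmx mul1mx mxE oppr_le0.
  - have := Fz i; rewrite !mxE big_ord1 !mxE mulrC.
    by under eq_bigr do rewrite mxE.
  - have := Gz (lshift 1 j); rewrite col_mxEu !mxE big_ord1 !mxE jJ mulrC.
    by under eq_bigr do rewrite mxE jJ.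
rewrite -[w]hsubmxK mul_row_col !mul_mx_row !add_row_mx mulmx0 addr0 => lw0.
have {lw0}[gradE sndE] : l *m U + lsubmx w *m V = 0 /\
    l *m ca + (lsubmx w *m cc + rsubmx w *m (- 1%:M)) = 0.
  by apply: eq_row_mx; rewrite row_mx0.
pose mu : 'rV[R]_m := \row_j (if j \in J then lsubmx w 0 j else 0).
right; exists l, mu; split=> // [j|j /negbTE jJ||].
- by rewrite !mxE; case: ifP.
- by rewrite mxE jJ.
- apply/rowP => k; move/rowP: gradE => /(_ k); rewrite !mxE => <-.
  rewrite !summxE; congr (_ + _); first by apply: eq_bigr => i _; rewrite !mxE.
  rewrite big_mkcond; apply: eq_bigr => j _; rewrite !mxE.
  by case: (j \in J); rewrite ?mulr0.
move/rowP: sndE => /(_ 0); rewrite mulmxN mulmx1 addrA !mxE => /eqP.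
rewrite subr_eq0 => /eqP sndE.
have -> : \sum_i l 0 i * a i + \sum_(j in J) mu 0 j * c j = w 0 (rshift m 0).
  rewrite -sndE; congr (_ + _); first by apply: eq_bigr => i _; rewrite !mxE.
  rewrite big_mkcond; apply: eq_bigr => j _; rewrite !mxE.
  by case: (j \in J); rewrite ?mulr0.
exact: w0.
Qed.

(** Weighting the inequalities by the multipliers and summing gives a negative
    number, because some lambda_i is positive; but the gradient part of that
    sum vanishes and the second-order part is nonnegative. *)
Lemma direction_multipliers_absurd (R : realFieldType) (s n m : nat)
    (u : 'I_n -> 'rV[R]_s) (a : 'I_n -> R)
    (v : 'I_m -> 'rV[R]_s) (c : 'I_m -> R) (J : {set 'I_m})
    (eta : 'rV[R]_s) (omega : R) (lambda : 'rV[R]_n) (mu : 'rV[R]_m) :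
  0 <= omega ->
  (forall i, (u i *m eta^T) 0 0 + omega * a i < 0) ->
  (forall j, j \in J -> (v j *m eta^T) 0 0 + omega * c j <= 0) ->
  (forall i, 0 <= lambda 0 i) -> lambda != 0 -> (forall j, 0 <= mu 0 j) ->
  \sum_i lambda 0 i *: u i + \sum_(j in J) mu 0 j *: v j = 0 ->
  0 <= \sum_i lambda 0 i * a i + \sum_(j in J) mu 0 j * c j -> False.
Proof.
move=> omega0 ltu lev l0 /rV0Pn[i0 li0] mu0 gradE snd0.
pose T := \sum_i lambda 0 i * ((u i *m eta^T) 0 0 + omega * a i) +
          \sum_(j in J) mu 0 j * ((v j *m eta^T) 0 0 + omega * c j).
have T_ge0 : 0 <= T.
  suff -> : T = omega * (\sum_i lambda 0 i * a i +
                         \sum_(j in J) mu 0 j * c j) by rewrite mulr_ge0.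
  have dotE : \sum_i lambda 0 i * (u i *m eta^T) 0 0 +
              \sum_(j in J) mu 0 j * (v j *m eta^T) 0 0 = 0.
    have := congr1 (fun r => (r *m eta^T) 0 0) gradE.
    rewrite mul0mx mulmxDl !mulmx_suml [in RHS]mxE mxE !summxE => dot0.
    rewrite -[RHS]dot0.
    by congr (_ + _); apply: eq_bigr => i _; rewrite -scalemxAl [RHS]mxE.
  rewrite /T; under eq_bigr do rewrite mulrDr mulrCA.
  under [X in _ + X]eq_bigr do rewrite mulrDr mulrCA.
  by rewrite !big_split /= addrACA dotE add0r -!mulr_sumr mulrDr.
suff : T < 0 by rewrite ltNge T_ge0.
rewrite /T (bigD1 i0) //= -addrA ltr_nwDl //.
  by rewrite nmulr_llt0 // lt_def li0 l0.
by apply: ler_wnDl; apply: sumr_le0 => k kP;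
  rewrite mulr_ge0_le0 ?lev // ltW.
Qed.

(** * Kuhn-Tucker stationarity and pseudoinvexity *)

Theorem theorem7 (R : realType) (s n m : nat) (X : set 'rV[R]_s)
    (f : 'rV[R]_s -> 'rV[R]_n) (g : 'rV[R]_s -> 'rV[R]_m)
    (openX : open X) (diff_fg : frechet_differentiable X f g) :
  (forall x, snd_KT_stationary X f g x ->
     weak_global_pareto_minimizer X f g x) <->
  snd_KT_pseudoinvex_I X f g.
Proof.
split=> [KT_min|[d [eta [omega [omega0 invex]]]] x [feas_x KT]]; last first.
  split=> // -[y feas_y fyx].
  have [crit der lt_f le_g] := invex _ _ feas_x feas_y fyx.
  have [lambda [mu [[l0 lN0] mu0 _ gradE snd0]]] := KT _ crit der.
  apply: direction_multipliers_absurd lt_f le_g l0 lN0 mu0 gradE snd0.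
  by apply: omega0; [case: feas_x | case: feas_y].
pose dominated x y := [/\ feasible X g x, feasible X g y &
  forall i, f y 0 i < f x 0 i].
pose solves x (w : 'rV[R]_s * 'rV[R]_s * R) := [/\ critical f g x w.1.1,
  problem_snd_derivable f g x w.1.1,
  forall i, grad_dot (comp_fun f i) x w.1.2 +
    w.2 * snd_derive (comp_fun f i) x w.1.1 < 0 &
  forall j, j \in active g x -> grad_dot (comp_fun g j) x w.1.2 +
    w.2 * snd_derive (comp_fun g j) x w.1.1 <= 0].
(* Pairs that are not dominated only need omega >= 0. *)
have sol xy : exists w, 0 <= w.2 /\ (dominated xy.1 xy.2 -> solves xy.1 w).
  case: xy => x y /=.
  have [[feas_x feas_y fyx]|ndom] := pselect (dominated x y); last first.
    by exists (0, 0, 0).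
  have notKT : ~ snd_KT_stationary X f g x.
    by move=> /KT_min[_]; apply; exists y.
  apply: contrapT => nosol; apply: notKT; split=> // d crit der.
  have [[eta [omega [omega0 lt_f le_g]]]|] := direction_or_multipliers
      (fun i => gradient (comp_fun f i) x)
      (fun i => snd_derive (comp_fun f i) x d)
      (fun j => gradient (comp_fun g j) x)
      (fun j => snd_derive (comp_fun g j) x d) (active g x).
    by exfalso; apply: nosol; exists (d, eta, omega).
  move=> [lambda [mu [l0 mu0 muJ gradE snd0]]]; exists lambda, mu; split=> // j.
  have [|/muJ ->] := boolP (j \in active g x); last by rewrite mul0r.
  by rewrite inE => /eqP ->; rewrite mulr0.
have [W WP] := choice sol.
exists (fun x y => (W (x, y)).1.1), (fun x y => (W (x, y)).1.2),
  (fun x y => (W (x, y)).2); split=> [x y _ _|x y feas_x feas_y fyx].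
  by case: (WP (x, y)).
by case: (WP (x, y)) => _; apply.
Qed.
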